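(* Let $\mathrm{ZX}_{\mathsf{simp}}$ be the simplified stabilizer ZX-calculus described in the context. The spider rule (S1), i.e. the family of equations $$(1_b\otimes R_Z^{(k+c,d)}(\beta))\circ(R_Z^{(a,b+k)}(\alpha)\otimes1_c)=R_Z^{(a+c,b+d)}(\alpha+\beta)\qquad(a,b,c,d\ge0,\ k\ge1,\ \alpha,\beta\in\tfrac\pi2\mathbb Z),$$ is necessary: $\mathrm{ZX}_{\mathsf{simp}}\setminus(\mathrm{S1})\not\vdash(\mathrm{S1})$. That is, when the whole family (S1) is removed, at least one of its instances is not derivable from the remaining rules.
   Context: **Diagrams.** Diagrams $D:n\to m$ ($n,m\in\mathbb N$) are the morphisms of the free strict monoidal category with objects $\mathbb N$ (tensor on objects is addition) generated by: green spiders $R_Z^{(n,m)}(\alpha):n\to m$ and red spiders $R_X^{(n,m)}(\alpha):n\to m$ for all $n,m\in\mathbb N$ and $\alpha\in\{k\pi/2\mid k\in\mathbb Z\}$ (angles are real numbers, not taken modulo $2\pi$); $H:1\to1$; the swap $\sigma:2\to2$; the cup $\epsilon:2\to0$; the cap $\eta:0\to2$. The identity on $n$ is $1_n$, and $e=1_0$ is the empty diagram. $D_2\circ D_1$ means first $D_1$ then $D_2$; in $D_1\otimes D_2$, $D_1$ is on the left. Put $R_Z^{(n,m)}:=R_Z^{(n,m)}(0)$, $R_X^{(n,m)}:=R_X^{(n,m)}(0)$. **Only connectivity matters (meta rule).** $G_D=(V,E,\ell)$ has one vertex for each spider, each $H$, each input and each output of $D$, and one edge for each wire of $D$ (wires being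 followed through swaps, cups and caps), joining the vertices at its two ends. A green (red) spider of angle $\alpha$ is labelled $R_Z(\alpha)$ ($R_X(\alpha)$), an $H$ is labelled $H$, the $j$-th input (output) from the left is labelled $I_j$ ($O_j$). The order and direction in which wires are attached to a spider or $H$ is not recorded. The meta rule: $D_1=D_2$ whenever there is a bijection of the vertices of $G_{D_1}$ and $G_{D_2}$ preserving labels and the number of edges between any two (possibly equal) vertices, and the two diagrams have the same number of closed wire loops carrying no vertex. **Calculus.** For a set $R$ of rules, $R\vdash D_1=D_2$ means that $(D_1,D_2)$ belongs to the smallest equivalence relation on parallel diagrams that is closed under $\circ$ and $\otimes$ and contains all equations in $R$. $\mathrm{ZX}_{\mathsf{simp}}$ consists of the meta rule above and of the following rules; $\mathrm{ZX}_{\mathsf{simp}}\setminus(\mathrm X)$ is obtained by deleting all instances of rule (X). - (S1) for all $a,b,c,d\ge0$, $k\ge1$ and all $\alpha,\beta$: $(1_b\otimes R_Z^{(k+c,d)}(\beta))\circ(R_Z^{(a,b+k)}(\alpha)\otimes1_c)=R_Z^{(a+c,b+d)}(\alpha+\beta)$ (ordinary addition of angles). - (S3$'$L) $\eta=R_Z^{(0,2)}$; (S3$'$R) $R_Z^{(0,2)}=R_X^{(0,2)}$. - (B1) $(R_Z^{(1,0)}\circ R_X^{(0,1)})\otimes(R_Z^{(1,2)}\circ R_X^{(0,1)})=R_X^{(0,1)}\otimes R_X^{(0,1)}$. - (B2$'$) $R_Z^{(0,0)}\otimes\big[(R_X^{(2,1)}\otimes R_X^{(2,1)})\circ(1_1\otimes\sigma\otimes1_1)\circ(R_Z^{(1,2)}\otimes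 R_Z^{(1,2)})\big]=(R_Z^{(1,0)}\circ R_X^{(0,1)})\otimes(R_Z^{(1,2)}\circ R_X^{(2,1)})$. - (EU$'$) $H=R_Z^{(1,1)}(\tfrac\pi2)\circ R_X^{(2,1)}\circ(R_Z^{(0,1)}(-\tfrac\pi2)\otimes1_1)\circ R_Z^{(1,1)}(\tfrac\pi2)$. - (H) for all $n,m,\alpha$: $H^{\otimes m}\circ R_X^{(n,m)}(\alpha)\circ H^{\otimes n}=R_Z^{(n,m)}(\alpha)$. - (IV$'$) $R_Z^{(0,0)}\otimes(R_X^{(3,0)}\circ R_Z^{(0,3)})\otimes(R_X^{(3,0)}\circ R_Z^{(0,3)})=e$. - (ZO$'$) $R_Z^{(0,0)}(\pi)\otimes R_Z^{(0,1)}=R_Z^{(0,0)}(\pi)\otimes R_X^{(0,1)}$. *)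

(* Defs.v *)
From HB Require Import structures.
From mathcomp Require Import all_boot all_order all_algebra.

Set Implicit Arguments.
Unset Strict Implicit.
Unset Printing Implicit Defensive.

Import GRing.Theory.

(* The angle k * pi / 2 is encoded by the integer k; angles are not reduced   *)
(* modulo 2 * pi.                                                             *)
Definition angle := int.
Definition angle_pi : angle := Posz 2.
Definition angle_pi2 : angle := Posz 1.

(* Terms for diagrams n -> m. The equations of strict monoidal categories     *)
(* are imposed separately, by smc_law below.                                  *)
Inductive diag : nat -> nat -> Type :=
| RZ (n m : nat) (a : angle) : diag n m
| RX (n m : nat) (a : angle) : diag n m
| Had : diag 1 1
| Swap : diag 2 2
| Cup : diag 2 0
| Cap : diag 0 2
| Id (n : nat) : diag n n
| Comp (n k m : nat) (D2 : diag k m) (D1 : diag n k) : diag n m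
| Tens (n1 m1 n2 m2 : nat) (D1 : diag n1 m1) (D2 : diag n2 m2) :
    diag (n1 + n2) (m1 + m2).

Declare Scope diag_scope.
Delimit Scope diag_scope with D.
Bind Scope diag_scope with diag.
Notation "D2 ∘ D1" := (Comp D2 D1)
  (at level 40, left associativity) : diag_scope.
Notation "D1 ⊗ D2" := (Tens D1 D2)
  (at level 39, left associativity) : diag_scope.
Local Open Scope diag_scope.

Notation RZ0 n m := (RZ n m 0%R).
Notation RX0 n m := (RX n m 0%R).

Definition castd (n n' m m' : nat) (en : n = n') (em : m = m')
    (D : diag n m) : diag n' m' :=
  let: erefl in _ = n' := en return diag n' m' in
  let: erefl in _ = m' := em return diag n m' in D.

Fixpoint Hpow (n : nat) : diag n n :=
  match n with
  | 0 => Id 0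
  | n'.+1 => Had ⊗ Hpow n'
  end.

(* The labelled multigraph G_D, with the closed loops of D counted apart.     *)

Inductive label :=
| LZ of angle
| LX of angle
| LH
| LIn of nat
| LOut of nat.

(* [node] lists the spiders and the H's; the inputs and the outputs are the   *)
(* remaining vertices. A wire is recorded by its two ends, in either order.   *)
Record graph (n m : nat) := Graph {
  node : finType;
  node_label : node -> label;
  wires : seq ((node + ('I_n + 'I_m)) * (node + ('I_n + 'I_m)));
  loops : nat
}.

Definition vertex (n m : nat) (G : graph n m) : finType :=
  (node G + ('I_n + 'I_m))%type.

Definition vnode (N : Type) (n m : nat) (v : N) : N + ('I_n + 'I_m) := inl v.
Definition vin (N : Type) (n m : nat) (i : 'I_n) : N + ('I_n + 'I_m) :=
  inr (inl i).
Definition vout (N : Type) (n m : nat) (j : 'I_m) : N + ('I_n + 'I_m) :=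
  inr (inr j).

Definition vlabel (n m : nat) (G : graph n m) (v : vertex G) : label :=
  match v with
  | inl x => node_label x
  | inr (inl i) => LIn i
  | inr (inr j) => LOut j
  end.

Definition edges_between (n m : nat) (G : graph n m) (u v : vertex G) : nat :=
  count (fun w : vertex G * vertex G => (w == (u, v)) || (w == (v, u)))
        (wires G).

Definition node_graph (l : label) (n m : nat) : graph n m :=
  @Graph n m unit (fun=> l)
    ([seq (vnode n m tt, vin _ m i) | i <- enum 'I_n] ++
     [seq (vnode n m tt, vout _ n j) | j <- enum 'I_m]) 0.

Definition wire_graph (n m : nat)
    (ws : seq ((void + ('I_n + 'I_m)) * (void + ('I_n + 'I_m)))) : graph n m :=
  @Graph n m void (fun v => match v with end) ws 0.

Definition map_wires (A B : Type) (f : A -> B) (ws : seq (A * A)) :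
    seq (B * B) :=
  [seq (f w.1, f w.2) | w <- ws].

Definition tens_graph (n1 m1 n2 m2 : nat)
    (G1 : graph n1 m1) (G2 : graph n2 m2) : graph (n1 + n2) (m1 + m2) :=
  let f1 (v : node G1 + ('I_n1 + 'I_m1)) :
      (node G1 + node G2) + ('I_(n1 + n2) + 'I_(m1 + m2)) :=
    match v with
    | inl x => vnode _ _ (inl x)
    | inr (inl i) => vin _ _ (lshift n2 i)
    | inr (inr j) => vout _ _ (lshift m2 j)
    end in
  let f2 (v : node G2 + ('I_n2 + 'I_m2)) :
      (node G1 + node G2) + ('I_(n1 + n2) + 'I_(m1 + m2)) :=
    match v with
    | inl x => vnode _ _ (inr x)
    | inr (inl i) => vin _ _ (rshift n1 i)
    | inr (inr j) => vout _ _ (rshift m1 j)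
    end in
  @Graph (n1 + n2) (m1 + m2) (node G1 + node G2)%type
    (fun v => match v with inl x => node_label x | inr y => node_label y end)
    (map_wires f1 (wires G1) ++ map_wires f2 (wires G2))
    (loops G1 + loops G2).

Definition other_end (T : eqType) (x : T) (w : T * T) : T :=
  if w.1 == x then w.2 else w.1.

(* The name x occurs exactly twice among the ends of the wires. If it names   *)
(* the ends of two wires, these are joined into one; if it names both ends of *)
(* one wire, that wire becomes a closed loop. The last case does not occur.   *)
Definition join_at (T : eqType) (s : seq (T * T) * nat) (x : T) :
    seq (T * T) * nat :=
  let at_x (w : T * T) := (w.1 == x) || (w.2 == x) in
  let rest := [seq w <- s.1 | ~~ at_x w] in
  match [seq w <- s.1 | at_x w] with
  | [:: w; w'] => ((other_end x w, other_end x w') :: rest, s.2)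
  | [:: _] => (rest, s.2.+1)
  | _ => s
  end.

(* Plugging the outputs of G1 into the inputs of G2: output j of G1 and input *)
(* j of G2 both become the junction [inr j], and then the wires are joined at *)
(* every junction, after which no end of a wire is a junction.                *)
Definition comp_graph (n k m : nat) (G2 : graph k m) (G1 : graph n k) :
    graph n m :=
  let V : finType := ((node G1 + node G2) + ('I_n + 'I_m))%type in
  let f1 (v : node G1 + ('I_n + 'I_k)) : V + 'I_k :=
    match v with
    | inl x => inl (vnode _ _ (inl x))
    | inr (inl i) => inl (vin _ _ i)
    | inr (inr j) => inr j
    end in
  let f2 (v : node G2 + ('I_k + 'I_m)) : V + 'I_k :=
    match v with
    | inl x => inl (vnode _ _ (inr x))
    | inr (inl j) => inr j
    | inr (inr i) => inl (vout _ _ i)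
    end in
  let joined :=
    foldl (@join_at (V + 'I_k)%type)
      (map_wires f1 (wires G1) ++ map_wires f2 (wires G2),
       loops G1 + loops G2)
      [seq inr j | j <- enum 'I_k] in
  let out_of_junction (w : (V + 'I_k) * (V + 'I_k)) : option (V * V) :=
    match w with
    | (inl u, inl v) => Some (u, v)
    | _ => None
    end in
  @Graph n m (node G1 + node G2)%type
    (fun v => match v with inl x => node_label x | inr y => node_label y end)
    (pmap out_of_junction joined.1) joined.2.

Fixpoint graph_of (n m : nat) (D : diag n m) : graph n m :=
  match D in diag n m return graph n m with
  | RZ n m a => node_graph (LZ a) n m
  | RX n m a => node_graph (LX a) n m
  | Had => node_graph LH 1 1
  | Swap => @wire_graph 2 2
      [:: (vin _ _ ord0, vout _ _ ord_max); (vin _ _ ord_max, vout _ _ ord0)]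
  | Cup => @wire_graph 2 0 [:: (vin _ _ ord0, vin _ _ ord_max)]
  | Cap => @wire_graph 0 2 [:: (vout _ _ ord0, vout _ _ ord_max)]
  | Id n => @wire_graph n n [seq (vin _ _ i, vout _ _ i) | i <- enum 'I_n]
  | Comp n k m D2 D1 => comp_graph (graph_of D2) (graph_of D1)
  | Tens n1 m1 n2 m2 D1 D2 => tens_graph (graph_of D1) (graph_of D2)
  end.

Definition same_connectivity (n m : nat) (G1 G2 : graph n m) : Prop :=
  (exists f : vertex G1 -> vertex G2,
    [/\ bijective f,
        forall v, vlabel (f v) = vlabel v
      & forall u v, edges_between (f u) (f v) = edges_between u v]) /\
  loops G1 = loops G2.

Inductive smc_law : forall n m : nat, diag n m -> diag n m -> Prop :=
| smc_compA n k l m (D1 : diag n k) (D2 : diag k l) (D3 : diag l m) :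
    smc_law (D3 ∘ (D2 ∘ D1)) (D3 ∘ D2 ∘ D1)
| smc_comp1l n m (D : diag n m) : smc_law (Id m ∘ D) D
| smc_comp1r n m (D : diag n m) : smc_law (D ∘ Id n) D
| smc_tensA n1 m1 n2 m2 n3 m3
    (D1 : diag n1 m1) (D2 : diag n2 m2) (D3 : diag n3 m3) :
    smc_law (castd (addnA n1 n2 n3) (addnA m1 m2 m3) (D1 ⊗ (D2 ⊗ D3)))
            (D1 ⊗ D2 ⊗ D3)
| smc_tens1l n m (D : diag n m) : @smc_law n m (Id 0 ⊗ D) D
| smc_tens1r n m (D : diag n m) :
    smc_law (castd (addn0 n) (addn0 m) (D ⊗ Id 0)) D
| smc_tens_id n m : smc_law (Id n ⊗ Id m) (Id (n + m))
| smc_interchange n1 k1 m1 n2 k2 m2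
    (D1 : diag n1 k1) (D2 : diag k1 m1) (E1 : diag n2 k2) (E2 : diag k2 m2) :
    smc_law ((D2 ∘ D1) ⊗ (E2 ∘ E1)) ((D2 ⊗ E2) ∘ (D1 ⊗ E1)).

Inductive rule_name :=
| Meta | S1 | S3'L | S3'R | B1 | B2' | EU' | HR | IV' | ZO'.

(* [ZXsimp r D1 D2]: the equation D1 = D2 is an instance of rule r.           *)
Inductive ZXsimp : rule_name -> forall n m : nat, diag n m -> diag n m -> Prop :=
| zx_meta n m (D1 D2 : diag n m) :
    same_connectivity (graph_of D1) (graph_of D2) -> ZXsimp Meta D1 D2
| zx_S1 a b c d k (al be : angle) : 1 <= k ->
    ZXsimp S1
      ((Id b ⊗ RZ (k + c) d be) ∘
         castd erefl (esym (addnA b k c)) (RZ a (b + k) al ⊗ Id c))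
      (RZ (a + c) (b + d) (al + be)%R)
| zx_S3L : ZXsimp S3'L Cap (RZ0 0 2)
| zx_S3R : ZXsimp S3'R (RZ0 0 2) (RX0 0 2)
| zx_B1 :
    @ZXsimp B1 0 2
      ((RZ0 1 0 ∘ RX0 0 1) ⊗ (RZ0 1 2 ∘ RX0 0 1))
      (RX0 0 1 ⊗ RX0 0 1)
| zx_B2 :
    @ZXsimp B2' 2 2
      (RZ0 0 0 ⊗
         ((RX0 2 1 ⊗ RX0 2 1) ∘ (Id 1 ⊗ Swap ⊗ Id 1) ∘ (RZ0 1 2 ⊗ RZ0 1 2)))
      ((RZ0 1 0 ∘ RX0 0 1) ⊗ (RZ0 1 2 ∘ RX0 2 1))
| zx_EU :
    @ZXsimp EU' 1 1
      Had
      (RZ 1 1 angle_pi2 ∘ RX0 2 1 ∘ (RZ 0 1 (- angle_pi2)%R ⊗ Id 1) ∘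
         RZ 1 1 angle_pi2)
| zx_H n m (al : angle) :
    ZXsimp HR (Hpow m ∘ RX n m al ∘ Hpow n) (RZ n m al)
| zx_IV :
    @ZXsimp IV' 0 0
      (RZ0 0 0 ⊗ (RX0 3 0 ∘ RZ0 0 3) ⊗ (RX0 3 0 ∘ RZ0 0 3))
      (Id 0)
| zx_ZO :
    @ZXsimp ZO' 0 1
      (RZ 0 0 angle_pi ⊗ RZ0 0 1)
      (RZ 0 0 angle_pi ⊗ RX0 0 1).

Definition equations := forall n m : nat, diag n m -> diag n m -> Prop.

Definition ZXsimp_without (r : rule_name) : equations :=
  fun n m D1 D2 => exists2 r', r' <> r & @ZXsimp r' n m D1 D2.

Inductive derivable (R : equations) :
    forall n m : nat, diag n m -> diag n m -> Prop :=
| der_rule n m (D1 D2 : diag n m) : R n m D1 D2 -> derivable R D1 D2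
| der_smc n m (D1 D2 : diag n m) : smc_law D1 D2 -> derivable R D1 D2
| der_refl n m (D : diag n m) : derivable R D D
| der_sym n m (D1 D2 : diag n m) : derivable R D1 D2 -> derivable R D2 D1
| der_trans n m (D1 D2 D3 : diag n m) :
    derivable R D1 D2 -> derivable R D2 D3 -> derivable R D1 D3
| der_comp n k m (D1 D1' : diag n k) (D2 D2' : diag k m) :
    derivable R D1 D1' -> derivable R D2 D2' ->
    derivable R (D2 ∘ D1) (D2' ∘ D1')
| der_tens n1 m1 n2 m2 (D1 D1' : diag n1 m1) (D2 D2' : diag n2 m2) :
    derivable R D1 D1' -> derivable R D2 D2' ->
    derivable R (D1 ⊗ D2) (D1' ⊗ D2').

(* Main.v *)
Require Import Defs.
From mathcomp Require Import all_boot all_order all_algebra.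

Set Implicit Arguments.
Unset Strict Implicit.
Unset Printing Implicit Defensive.

(** Count the spiders, green or red, whose angle is exactly [3 * pi / 2]. Since
angles are not reduced modulo [2 * pi], this number depends only on the labels
of the graph, so the meta rule preserves it. Rule (H) preserves it because it
only changes the colour of a spider, and the other rules apart from (S1) only
mention the angles [0], [pi / 2], [- pi / 2] and [pi]. Fusing spiders of angles
[pi / 2] and [pi] changes it from [0] to [1]. *)

Definition label_has_angle (a : angle) (l : label) : bool :=
  match l with
  | LZ b | LX b => b == a
  | _ => false
  end.

Fixpoint count_angle (a : angle) (n m : nat) (D : diag n m) : nat :=
  match D with
  | RZ _ _ b | RX _ _ b => b == a
  | Comp _ _ _ D2 D1 => count_angle a D2 + count_angle a D1
  | Tens _ _ _ _ D1 D2 => count_angle a D1 + count_angle a D2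
  | _ => 0
  end.

Local Arguments castd : simpl never.

Lemma count_angle_castd a n n' m m' (en : n = n') (em : m = m') (D : diag n m) :
  count_angle a (castd en em D) = count_angle a D.
Proof. by case: _ / en; case: _ / em. Qed.

Lemma count_angle_Hpow a n : count_angle a (Hpow n) = 0.
Proof. by elim: n. Qed.

(** Composition and tensor both take the disjoint union of the nodes; joining wires creates and
    removes none. So the syntactic count can be read off the graph. *)
Lemma sum_node_label_angle a n m (D : diag n m) :
  \sum_(x : node (graph_of D)) label_has_angle a (node_label x) =
  count_angle a D.
Proof.
elim: D => //=.
- by move=> n' m' b; rewrite (big_pred1 tt) //; case.
- by move=> n' m' b; rewrite (big_pred1 tt) //; case.
- by rewrite big1.
- by rewrite big1 //; case.
- by rewrite big1 //; case.
- by rewrite big1 //; case.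
- by move=> n'; rewrite big1 //; case.
- by move=> n' k m' D2 IH2 D1 IH1; rewrite big_sumType /= IH1 IH2 addnC.
- by move=> n1 m1 n2 m2 D1 IH1 D2 IH2; rewrite big_sumType /= IH1 IH2.
Qed.

(** Inputs and outputs carry no angle. *)
Lemma sum_vlabel_angle a n m (G : graph n m) :
  \sum_(v : vertex G) label_has_angle a (vlabel v) =
  \sum_(x : node G) label_has_angle a (node_label x).
Proof. by rewrite !big_sumType /= !big1_eq !addn0. Qed.

Lemma count_angle_meta a n m (D1 D2 : diag n m) :
  same_connectivity (graph_of D1) (graph_of D2) ->
  count_angle a D1 = count_angle a D2.
Proof.
move=> [[f [fbij flab _]] _].
rewrite -!sum_node_label_angle -!sum_vlabel_angle [RHS](reindex f) /=.
  by apply: eq_bigr => v _; rewrite flab.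
exact: onW_bij.
Qed.

Lemma count_angle_smc a n m (D1 D2 : diag n m) :
  smc_law D1 D2 -> count_angle a D1 = count_angle a D2.
Proof.
case=> * /=; rewrite ?count_angle_castd /= ?addn0 ?add0n //.
- exact: addnA.
- exact: addnA.
- exact: addnACA.
Qed.

Lemma count_angle_rule r n m (D1 D2 : diag n m) :
  r <> S1 -> ZXsimp r D1 D2 -> count_angle 3 D1 = count_angle 3 D2.
Proof.
(* For the rules with fixed angles both counts compute to [0]; the meta rule and (H) remain. *)
move=> r_neq zx; case: {n m D1 D2} zx r_neq => //.
  by move=> n m D1 D2 /count_angle_meta.
by move=> n m b _; rewrite /= !count_angle_Hpow addn0.
Qed.

Lemma count_angle_derivable n m (D1 D2 : diag n m) :
  derivable (ZXsimp_without S1) D1 D2 -> count_angle 3 D1 = count_angle 3 D2.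
Proof.
elim=> {n m D1 D2} //.
- by move=> n m D1 D2 [r]; apply: count_angle_rule.
- by move=> n m D1 D2 /count_angle_smc.
- by move=> n m D1 D2 D3 _ -> _ ->.
- by move=> n k m D1 D1' D2 D2' _ /= -> _ ->.
- by move=> n1 m1 n2 m2 D1 D1' D2 D2' _ /= -> _ ->.
Qed.

Theorem lemma3p1 :
  exists (n m : nat) (D1 D2 : diag n m),
    @ZXsimp S1 n m D1 D2 /\ ~ @derivable (ZXsimp_without S1) n m D1 D2.
Proof.
(* Two spiders joined by a single wire, with no other legs: the angles [1] and [2] are not [3], but
   their sum is. *)
do 4 eexists; split; first exact: (@zx_S1 0 0 0 0 1 angle_pi2 angle_pi).
by move/count_angle_derivable; rewrite /= count_angle_castd.
Qed.
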